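(* Let $IS\in\{\Box,\blacksquare\}^2$ be any initial store with two locks, and let $\tau$ be a compositional translation from $\mathrm{SYNCSIMPLE}$ into $\mathrm{LOCKSIMPLE}_{2,IS}$. Then $\tau$ is not correct.
   Context: $\mathrm{SYNCSIMPLE}$: subprocesses are $\mathcal{U} ::= \checkmark \mid 0 \mid\, !\mathcal{U} \mid\, ?\mathcal{U}$; a process is a finite parallel composition $\mathcal{U}_1\mid\cdots\mid\mathcal{U}_n$ ($\mid$ associative, commutative, $0$ a unit). Reduction: $!\mathcal{U}_1\mid ?\mathcal{U}_2\mid \mathcal{P}\to \mathcal{U}_1\mid\mathcal{U}_2\mid\mathcal{P}$. Successful: of the form $\checkmark\mid\mathcal{P}$. May-convergent: reduces in zero or more steps to a successful process; must-convergent: every reachable process is may-convergent. $\mathrm{LOCKSIMPLE}_{k,IS}$ ($k$ locks, initial store $IS\in\{\Box,\blacksquare\}^k$, $\Box$ empty, $\blacksquare$ full): subprocesses are words over $\{P_1,T_1,\dots,P_k,T_k\}$ followed by $0$ or $\checkmark$, processes are parallel compositions. States $(\mathcal{P},C)$, $C\in\{\Box,\blacksquare\}^k$: $(P_i\mathcal{U}\mid\mathcal{P},C)\to(\mathcal{U}\mid\mathcal{P},C[C_i:=\blacksquare])$ only if $C_i=\Box$; $(T_i\mathcal{U}\mid\mathcal{P},C)\to(\mathcal{U}\mid\mathcal{P},C[C_i:=\Box])$ always. A state is successful if its process contains $\checkmark$; may-/must-convergence of states defined analogously; a process $\mathcal{P}$ is may/must-convergent iff $(\mathcal{P},IS)$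 is. A compositional translation $\tau$ is given by words $\tau(!),\tau(?)$ over $\{P_i,T_i\}$ with $\tau(0)=0$, $\tau(\checkmark)=\checkmark$, $\tau(!\mathcal{U})=\tau(!)\tau(\mathcal{U})$, $\tau(?\mathcal{U})=\tau(?)\tau(\mathcal{U})$, $\tau(\mathcal{P}_1\mid\mathcal{P}_2)=\tau(\mathcal{P}_1)\mid\tau(\mathcal{P}_2)$. It is correct if for every $\mathrm{SYNCSIMPLE}$-process $\mathcal{P}$: $\mathcal{P}$ is may-convergent iff $\tau(\mathcal{P})$ is, and must-convergent iff $\tau(\mathcal{P})$ is. *)

(* Defs.v *)
From Stdlib Require Import List Permutation Arith.
Import ListNotations.

Inductive SU : Type :=
| SCheck : SU
| SZero : SU
| SSend : SU -> SU
| SRecv : SU -> SU.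

(* A process U1 | ... | Un is a finite list of subprocesses; parallel
   composition is list concatenation, considered up to permutation. *)
Definition SProc := list SU.

Definition sred (P Q : SProc) : Prop :=
  exists U1 U2 R, Permutation P (SSend U1 :: SRecv U2 :: R)
                  /\ Permutation Q (U1 :: U2 :: R).

Inductive star {A : Type} (r : A -> A -> Prop) : A -> A -> Prop :=
| star_refl x : star r x x
| star_step x y z : r x y -> star r y z -> star r x z.

Definition s_successful (P : SProc) : Prop := In SCheck P.
Definition s_may (P : SProc) : Prop :=
  exists Q, star sred P Q /\ s_successful Q.
Definition s_must (P : SProc) : Prop :=
  forall Q, star sred P Q -> s_may Q.

(* lock actions P_i (take) and T_i (release); locks indexed by nat,
   lock i meaningful for i < k *)
Inductive lact : Type := LP (i : nat) | LT (i : nat).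
Definition lact_idx (a : lact) : nat := match a with LP i => i | LT i => i end.

Inductive LU : Type :=
| LCheck : LU
| LZero : LU
| LAct : lact -> LU -> LU.

Definition LProc := list LU.
(* store: true = full (black square), false = empty (white square) *)
Definition store := nat -> bool.
Definition upd (C : store) (i : nat) (b : bool) : store :=
  fun j => if Nat.eqb j i then b else C j.

Definition lstate := (LProc * store)%type.

Definition lred (s t : lstate) : Prop :=
  exists a u R, Permutation (fst s) (LAct a u :: R)
    /\ Permutation (fst t) (u :: R)
    /\ match a with
       | LP i => snd s i = false /\ snd t = upd (snd s) i true
       | LT i => snd t = upd (snd s) i false
       end.

Definition l_successful (s : lstate) : Prop := In LCheck (fst s).
Definition l_may (s : lstate) : Prop :=
  exists t, star lred s t /\ l_successful t.
Definition l_must (s : lstate) : Prop :=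
  forall t, star lred s t -> l_may t.

Definition word_ok (k : nat) (w : list lact) : Prop :=
  forall a, In a w -> lact_idx a < k.

Fixpoint prefix (w : list lact) (u : LU) : LU :=
  match w with
  | [] => u
  | a :: w' => LAct a (prefix w' u)
  end.

Fixpoint tauU (tsend trecv : list lact) (U : SU) : LU :=
  match U with
  | SCheck => LCheck
  | SZero => LZero
  | SSend U' => prefix tsend (tauU tsend trecv U')
  | SRecv U' => prefix trecv (tauU tsend trecv U')
  end.

Definition tauP (tsend trecv : list lact) (P : SProc) : LProc :=
  map (tauU tsend trecv) P.

Definition correct_translation (IS : store) (tsend trecv : list lact) : Prop :=
  forall P : SProc,
    (s_may P <-> l_may (tauP tsend trecv P, IS)) /\
    (s_must P <-> l_must (tauP tsend trecv P, IS)).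

(* Main.v *)
(* Let s and r be the words encoding ! and ?. If the translation is correct, then
   from the initial store m copies of s and n copies of r, run in parallel, never
   get stuck before min(m,n) of each are through, and all of them can get through
   only if m and n differ by at most one: a surplus of two would let two copies of
   r pass alone in sequence, hence (passing twice yields the same store as passing
   once) arbitrarily many, which !0^m | ?0^n | ?^(m+1)✓ forbids.

   Call a store good for (s,r) if it has these properties, with some bound on the
   surplus. Since T is idempotent, all copies of s but one can often be driven
   through a prefix of s without changing the store; letting the remaining pair
   finish, one gets a store that is good for the shortened word. By induction on
   the lengths only one shape survives: a one-place buffer, where s leads from
   "only lock 2 full" to "only lock 1 full", and r back. In that case one of !✓,
   ?✓, !0 | ??✓, ?0 | !!✓ may converge after translation, although it may not
   converge in the source calculus. *)
Require Import Defs.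
From Stdlib Require Import List Permutation Arith Bool Lia.
Import ListNotations.

(** * Words acting on two locks *)

Inductive act : Type := Take (l : bool) | Free (l : bool).

Definition word := list act.

(* A pair of cells, [true] meaning full; the lock named [true] is the second
   component. *)
Definition cells := (bool * bool)%type.

Definition get (l : bool) (C : cells) : bool := if l then snd C else fst C.

(* [cells_of l x y]: lock [l] is in state [x] and the other lock in state [y]. *)
Definition cells_of (l x y : bool) : cells := if l then (y, x) else (x, y).

Definition set (l x : bool) (C : cells) : cells :=
  cells_of l x (get (negb l) C).

Definition do_act (a : act) (C : cells) : option cells :=
  match a with
  | Take l => if get l C then None else Some (set l true C)
  | Free l => Some (set l false C)
  end.

Fixpoint exec (w : word) (C : cells) : option cells :=
  match w with
  | [] => Some C
  | a :: w' => match do_act a C with Some C' => exec w' C' | None => None end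
  end.

Definition lock (a : act) : bool := match a with Take l => l | Free l => l end.

Definition only (l : bool) (w : word) : Prop := Forall (fun a => lock a = l) w.

Definition le_cells (C D : cells) : Prop :=
  forall l, get l C = true -> get l D = true.

Lemma cells_eta (l : bool) (C : cells) : C = cells_of l (get l C) (get (negb l) C).
Proof. destruct C, l; reflexivity. Qed.

Lemma cells_ext (C D : cells) : (forall l, get l C = get l D) -> C = D.
Proof.
  intros H. rewrite (cells_eta true C), (cells_eta true D), H, H. reflexivity.
Qed.

Lemma get_cells_of (l x y : bool) : get l (cells_of l x y) = x.
Proof. destruct l; reflexivity. Qed.

Lemma get_cells_of_other (l x y : bool) : get (negb l) (cells_of l x y) = y.
Proof. destruct l; reflexivity. Qed.

Lemma cells_of_negb (l x y : bool) : cells_of (negb l) x y = cells_of l y x.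
Proof. destruct l; reflexivity. Qed.

Lemma set_cells_of (l b x y : bool) : set l b (cells_of l x y) = cells_of l b y.
Proof. destruct l; reflexivity. Qed.

Lemma set_cells_of_other (l b x y : bool) :
  set (negb l) b (cells_of l x y) = cells_of l x b.
Proof. destruct l; reflexivity. Qed.

Lemma get_do_act (a : act) (C D : cells) (l : bool) :
  do_act a C = Some D ->
  get l D = if eqb (lock a) l
            then match a with Take _ => true | Free _ => false end
            else get l C.
Proof.
  destruct a as [k|k]; simpl; intros H;
    [destruct (get k C) eqn:E; [discriminate|]|]; injection H as <-;
    destruct C, k, l; reflexivity.
Qed.

Lemma exec_app (u v : word) (C D : cells) :
  exec u C = Some D -> exec (u ++ v) C = exec v D.
Proof.
  revert C; induction u as [|a u IH]; simpl; intros C H.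
  - congruence.
  - destruct (do_act a C); [auto|discriminate].
Qed.

(** Only a full lock blocks an action, and what an action writes does not depend on the store; so
    emptying locks beforehand disables nothing. *)
Lemma exec_mono (u : word) (C C' D : cells) :
  le_cells C' C -> exec u C = Some D ->
  exists D', exec u C' = Some D' /\ le_cells D' D.
Proof.
  revert C C'; induction u as [|a u IH]; simpl; intros C C' Hle H.
  - injection H as <-. eauto.
  - destruct (do_act a C) as [E|] eqn:Ea; [|discriminate].
    assert (exists E', do_act a C' = Some E') as [E' Ea'].
    { destruct a as [k|k]; simpl in *; [|eauto].
      destruct (get k C') eqn:Ek; [|eauto].
      rewrite (Hle _ Ek) in Ea. discriminate. }
    rewrite Ea'. apply (IH E); [|assumption].
    intros l. rewrite (get_do_act _ _ _ l Ea), (get_do_act _ _ _ l Ea').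
    destruct (eqb (lock a) l); auto.
Qed.

(* The last action of a word on a lock decides the state it leaves there. *)
Lemma exec_effect (u : word) (l : bool) :
  (forall C D, exec u C = Some D -> get l D = get l C) \/
  (exists b, forall C D, exec u C = Some D -> get l D = b).
Proof.
  induction u as [|a u IH].
  - left. simpl. intros; congruence.
  - destruct IH as [IH|[b IH]].
    + destruct (bool_dec (lock a) l) as [El|El].
      * right. exists (match a with Take _ => true | Free _ => false end).
        intros C D. simpl. destruct (do_act a C) as [E|] eqn:Ea; [|discriminate].
        intros H. rewrite (IH _ _ H), (get_do_act _ _ _ l Ea), El, eqb_reflx.
        reflexivity.
      * left. intros C D. simpl.
        destruct (do_act a C) as [E|] eqn:Ea; [|discriminate].
        intros H. rewrite (IH _ _ H), (get_do_act _ _ _ l Ea).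
        apply eqb_false_iff in El. rewrite El. reflexivity.
    + right. exists b. intros C D. simpl.
      destruct (do_act a C); [apply IH|discriminate].
Qed.

Lemma exec_idempotent (u : word) (C D E : cells) :
  exec u C = Some D -> exec u D = Some E -> E = D.
Proof.
  intros H1 H2. apply cells_ext. intros l.
  destruct (exec_effect u l) as [H|[b H]].
  - auto.
  - rewrite (H _ _ H1). eauto.
Qed.

Lemma exec_same_lock (u : word) (l : bool) (C C' D D' : cells) :
  exec u C = Some D -> exec u C' = Some D' -> get l C = get l C' ->
  get l D = get l D'.
Proof.
  intros H1 H2 E. destruct (exec_effect u l) as [H|[b H]].
  - rewrite (H _ _ H1), (H _ _ H2). exact E.
  - rewrite (H _ _ H1), (H _ _ H2). reflexivity.
Qed.

(** By monotonicity the other lock still ends empty, and the final state of [l] depends only on its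
    initial one. *)
Lemma exec_swap_emptier (u : word) (l b : bool) :
  exec u (cells_of l false true) = Some (cells_of l true false) ->
  exec u (cells_of l false b) = Some (cells_of l true false).
Proof.
  intros H. destruct (exec_mono u (cells_of l false true) (cells_of l false b)
              (cells_of l true false)) as [D [HD Hle]]; [|exact H|].
  { intros k. destruct k, l, b; simpl; auto. }
  rewrite HD. f_equal. rewrite (cells_eta l D). f_equal.
  - rewrite (exec_same_lock _ l _ _ _ _ HD H); destruct l; reflexivity.
  - specialize (Hle (negb l)). rewrite get_cells_of_other in Hle.
    destruct (get (negb l) D); [discriminate (Hle eq_refl)|reflexivity].
Qed.

Lemma exec_cases (w : word) (C : cells) :
  (exists D, exec w C = Some D) \/
  (exists u l v D, w = u ++ Take l :: v /\ exec u C = Some D /\ get l D = true).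
Proof.
  revert C; induction w as [|a w IH]; intros C; simpl; [eauto|].
  destruct (do_act a C) as [E|] eqn:Ea.
  - destruct (IH E) as [H|(u & l & v & D & -> & H & Hl)]; [auto|].
    right. exists (a :: u), l, v, D. simpl. rewrite Ea. auto.
  - right. destruct a as [l|l]; simpl in Ea; [|discriminate].
    destruct (get l C) eqn:El; [|discriminate].
    exists [], l, w, C. auto.
Qed.

Lemma split_only (l : bool) (w : word) :
  exists q rest, w = q ++ rest /\ only (negb l) q /\
    (rest = [] \/ (exists v, rest = Take l :: v) \/ (exists v, rest = Free l :: v)).
Proof.
  induction w as [|a w (q & rest & -> & Hq & Hrest)].
  - exists [], []. repeat split; auto. constructor.
  - destruct (bool_dec (lock a) l) as [<-|E].
    + exists [], (a :: q ++ rest). repeat split; [constructor|].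
      destruct a; simpl; eauto.
    + exists (a :: q), rest. repeat split; auto.
      constructor; [|assumption]. destruct (lock a), l; simpl; congruence.
Qed.

Lemma exec_only (k : bool) (q : word) (x y : bool) (D : cells) :
  only k q -> exec q (cells_of k x y) = Some D ->
  exists x', D = cells_of k x' y /\
    forall y', exec q (cells_of k x y') = Some (cells_of k x' y').
Proof.
  intros Hq. revert x. induction Hq as [|a q <- Hq IH]; simpl; intros x H.
  - injection H as <-. eauto.
  - destruct a as [k|k]; simpl in *.
    + rewrite get_cells_of in H. destruct x; [discriminate|].
      rewrite set_cells_of in H. destruct (IH _ H) as (x' & -> & H').
      exists x'. split; [reflexivity|]. intros y'.
      rewrite get_cells_of, set_cells_of. apply H'.
    + rewrite set_cells_of in H. destruct (IH _ H) as (x' & -> & H').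
      exists x'. split; [reflexivity|]. intros y'.
      rewrite set_cells_of. apply H'.
Qed.

Definition starts_with (a : act) (w : word) : Prop := exists v, w = a :: v.

(** Such a word is empty or begins with [Free k], which erases the initial state of lock [k]. In
    both cases the state it leaves is a fixed point of a further run. *)
Lemma exec_only_any (k : bool) (q : word) (x y x1 y1 : bool) (D : cells) :
  only k q -> ~ starts_with (Take k) q -> exec q (cells_of k x y) = Some D ->
  exists x2, exec q (cells_of k x1 y1) = Some (cells_of k x2 y1) /\
    forall y2, exec q (cells_of k x2 y2) = Some (cells_of k x2 y2).
Proof.
  intros Hq Hstart H. destruct Hq as [|a q <- Hq].
  - exists x1. auto.
  - destruct a as [k|k]; [exfalso; apply Hstart; eexists; reflexivity|].
    simpl in *. rewrite set_cells_of in H.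
    destruct (exec_only _ _ _ _ _ Hq H) as (x2 & _ & H2).
    exists x2. split; [|intros y2]; rewrite set_cells_of; apply H2.
Qed.

(** * Systems of processes over two locks *)

(** The tag never influences a run. It records the kind of a process, its continuation, or both, as
    an argument requires. *)
Definition config (A : Type) := list (A * word).

Inductive reach {A : Type} : config A -> cells -> config A -> cells -> Prop :=
| reach_perm L L' C : Permutation L L' -> reach L C L' C
| reach_act x a w R L C C' L' D :
    Permutation L ((x, a :: w) :: R) -> do_act a C = Some C' ->
    reach ((x, w) :: R) C' L' D -> reach L C L' D.

(** A finished process counts as blocked, so that [stuck] means that no step is possible. *)
Definition blocked {A : Type} (C : cells) (e : A * word) : Prop :=
  match snd e with [] => True | a :: _ => do_act a C = None end.

Definition stuck {A : Type} (L : config A) (C : cells) : Prop :=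
  Forall (blocked C) L.

Definition finished {A : Type} (e : A * word) : Prop := snd e = [].

Definition live (t : bool) (e : bool * word) : Prop := fst e = t -> snd e <> [].

Section Reach.
Context {A : Type}.
Implicit Types L R K : config A.

Lemma reach_refl L C : reach L C L C.
Proof. now apply reach_perm. Qed.

Lemma reach_perm_l L L' C K D : Permutation L L' -> reach L' C K D -> reach L C K D.
Proof.
  intros P H. destruct H.
  - apply reach_perm. etransitivity; eassumption.
  - eapply reach_act; [|eassumption..]. etransitivity; eassumption.
Qed.

Lemma reach_trans L C L' C' L'' C'' :
  reach L C L' C' -> reach L' C' L'' C'' -> reach L C L'' C''.
Proof.
  induction 1; intros H'.
  - eapply reach_perm_l; eassumption.
  - eapply reach_act; eauto.
Qed.

Lemma reach_perm_r L C L' K D : reach L C L' D -> Permutation L' K -> reach L C K D.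
Proof. intros H P. eapply reach_trans; [eassumption|now apply reach_perm]. Qed.

Lemma reach_frame L C L' D R : reach L C L' D -> reach (L ++ R) C (L' ++ R) D.
Proof.
  induction 1 as [L L' C P|x a w S L C C' L' D P E _ IH].
  - apply reach_perm. now apply Permutation_app_tail.
  - eapply reach_act; [|eassumption|exact IH].
    apply (Permutation_app_tail R) in P. exact P.
Qed.

Lemma reach_exec x u w R C D :
  exec u C = Some D -> reach ((x, u ++ w) :: R) C ((x, w) :: R) D.
Proof.
  revert C; induction u as [|a u IH]; simpl; intros C H.
  - injection H as <-. apply reach_refl.
  - destruct (do_act a C) as [E|] eqn:Ea; [|discriminate].
    eapply reach_act; [reflexivity|eassumption|auto].
Qed.

Lemma reach_exec_all x u R C D :
  exec u C = Some D -> reach ((x, u) :: R) C ((x, []) :: R) D.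
Proof. intros H. rewrite <- (app_nil_r u) at 1. now apply reach_exec. Qed.

Lemma reach_tags L C L' D : reach L C L' D -> Permutation (map fst L) (map fst L').
Proof.
  induction 1 as [L L' C P|x a w S L C C' L' D P E _ IH].
  - now apply Permutation_map.
  - rewrite <- IH. apply (Permutation_map fst) in P. exact P.
Qed.

Lemma stuck_or_step L C :
  stuck L C \/
  exists x a w R C', Permutation L ((x, a :: w) :: R) /\ do_act a C = Some C'.
Proof.
  induction L as [|[x [|a w]] L [IH|(y & b & v & R & C' & P & E)]].
  - left. constructor.
  - left. constructor; [exact I|exact IH].
  - right. exists y, b, v, ((x, []) :: R), C'. split; [|exact E].
    rewrite P. apply perm_swap.
  - destruct (do_act a C) as [C'|] eqn:Ea.
    + right. exists x, a, w, L, C'. auto.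
    + left. constructor; assumption.
  - right. exists y, b, v, ((x, a :: w) :: R), C'. split; [|exact E].
    rewrite P. apply perm_swap.
Qed.

Lemma reach_stuck L C : exists L' D, reach L C L' D /\ stuck L' D.
Proof.
  remember (list_sum (map (fun e => length (snd e)) L)) as n eqn:En.
  revert L C En. induction n as [n IH] using lt_wf_ind. intros L C En.
  destruct (stuck_or_step L C) as [S|(x & a & w & R & C' & P & E)].
  - exists L, C. split; [apply reach_refl|exact S].
  - destruct (IH (list_sum (map (fun e => length (snd e)) ((x, w) :: R))))
      with (L := (x, w) :: R) (C := C') as (L' & D & H & S); [|reflexivity|].
    + apply (Permutation_map (fun e => length (snd e))) in P.
      apply Permutation_list_sum in P. rewrite En, P. simpl. lia.
    + exists L', D. split; [|exact S]. eapply reach_act; eassumption.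
Qed.

Lemma reach_exec_clones x u s n R C :
  exec u C = Some C ->
  reach (repeat (x, u ++ s) n ++ R) C (repeat (x, s) n ++ R) C.
Proof.
  intros H. induction n as [|n IH]; simpl; [apply reach_refl|].
  eapply reach_trans; [apply reach_exec, H|].
  eapply reach_perm_l; [apply Permutation_cons_append|].
  eapply reach_perm_r; [|symmetry; apply Permutation_cons_append].
  exact (reach_frame _ _ _ _ [(x, s)] IH).
Qed.

End Reach.

Lemma reach_map {A B : Type} (f : A -> B) L C L' D :
  reach L C L' D ->
  reach (map (fun e => (f (fst e), snd e)) L) C
        (map (fun e => (f (fst e), snd e)) L') D.
Proof.
  induction 1 as [L L' C P|x a w S L C C' L' D P E _ IH].
  - apply reach_perm. now apply Permutation_map.
  - eapply reach_act; [|eassumption|exact IH].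
    apply (Permutation_map (fun e => (f (fst e), snd e))) in P. exact P.
Qed.

(** Steps neither read nor change tags, so tags put on the final configuration can be traced back to
    the start. This permits choosing continuations with hindsight. *)
Lemma reach_lift {A B : Type} (f : A -> B) L C L' D (K' : config A) :
  reach L C L' D -> Permutation L' (map (fun e => (f (fst e), snd e)) K') ->
  exists K, Permutation L (map (fun e => (f (fst e), snd e)) K) /\ reach K C K' D.
Proof.
  intros H. induction H as [L L' C P|x a w S L C C' L' D P E _ IH]; intros PK.
  - exists K'. split; [etransitivity; eassumption|apply reach_refl].
  - destruct (IH PK) as (K & PL & HK).
    destruct (Permutation_map_inv _ _ PL) as (K1 & E1 & P1).
    destruct K1 as [|[y v] K1]; [discriminate|].
    injection E1 as -> -> ->.
    exists ((y, a :: v) :: K1). split; [exact P|].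
    eapply reach_act; [reflexivity|eassumption|].
    eapply reach_perm_l; [symmetry; eassumption|exact HK].
Qed.

(** * Counting finished processes *)

Definition count {A : Type} (f : A -> bool) (l : list A) : nat := length (filter f l).

Lemma count_perm {A : Type} (f : A -> bool) (l l' : list A) :
  Permutation l l' -> count f l = count f l'.
Proof.
  unfold count. induction 1; simpl; try congruence.
  - destruct (f x); simpl; congruence.
  - destruct (f x), (f y); reflexivity.
Qed.

Lemma count_cons {A : Type} (f : A -> bool) (x : A) (l : list A) :
  count f (x :: l) = (if f x then 1 else 0) + count f l.
Proof. unfold count. simpl. destruct (f x); reflexivity. Qed.

Lemma count_app {A : Type} (f : A -> bool) (l l' : list A) :
  count f (l ++ l') = count f l + count f l'.
Proof. unfold count. now rewrite filter_app, length_app. Qed.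

Lemma count_map {A B : Type} (f : B -> bool) (g : A -> B) (l : list A) :
  count f (map g l) = count (fun x => f (g x)) l.
Proof.
  induction l as [|x l IH]; [reflexivity|].
  simpl map. now rewrite !count_cons, IH.
Qed.

Lemma count_repeat {A : Type} (f : A -> bool) (x : A) (n : nat) :
  count f (repeat x n) = if f x then n else 0.
Proof.
  induction n as [|n IH]; simpl; [destruct (f x); reflexivity|].
  rewrite count_cons, IH. destruct (f x); reflexivity.
Qed.

Definition is_done (t : bool) (e : bool * word) : bool :=
  eqb (fst e) t && match snd e with [] => true | _ => false end.

Definition done (t : bool) (L : config bool) : nat := count (is_done t) L.

Lemma done_live (t : bool) (L : config bool) : Forall (live t) L -> done t L = 0.
Proof.
  unfold done. induction 1 as [|[x w] L H _ IH]; [reflexivity|].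
  rewrite count_cons, IH. unfold is_done, live in *; simpl in *.
  destruct (eqb_spec x t) as [e|]; [|reflexivity].
  destruct w; [destruct (H e eq_refl)|reflexivity].
Qed.

(** * Stores that are good for a pair of words *)

Definition init (s r : word) (m n : nat) : config bool :=
  repeat (true, s) m ++ repeat (false, r) n.

(* The words [Take l; Free (negb l)] and [Take (negb l); Free l] are good, with
   [B = 1], at the store where only [negb l] is full; so goodness alone is not
   contradictory. *)
Record good (s r : word) (C : cells) : Prop := {
  good_lower : forall t m n L D,
    reach (init s r m n) C L D -> stuck L D -> min m n <= done t L;
  good_upper : exists B, forall m n L D,
    reach (init s r m n) C L D -> Forall finished L -> m <= n + B /\ n <= m + B
}.

Lemma good_sym (s r : word) (C : cells) : good s r C -> good r s C.
Proof.
  assert (flip : forall m n L D, reach (init r s m n) C L D ->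
      reach (init s r n m) C (map (fun e => (negb (fst e), snd e)) L) D).
  { intros m n L D H. apply (reach_map negb) in H.
    unfold init in *. rewrite map_app, !map_repeat in H. simpl in H.
    eapply reach_perm_l; [apply Permutation_app_comm|exact H]. }
  intros [Hlow [B Hup]]. split.
  - intros t m n L D H S. apply flip in H. apply Hlow with (t := negb t) in H.
    + rewrite Nat.min_comm. unfold done in *. rewrite count_map in H.
      replace (count (is_done t) L)
        with (count (fun x => is_done (negb t) (negb (fst x), snd x)) L); [exact H|].
      unfold count. f_equal. apply filter_ext. intros [[] w]; destruct t; reflexivity.
    + apply Forall_map. exact S.
  - exists B. intros m n L D H S. apply flip in H. apply Hup in H; [tauto|].
    apply Forall_map. exact S.
Qed.

(** With a process of each kind present, the lower bound demands a finished one of kind [t].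
    Deadlocks become contradictions in this way. *)
Lemma good_not_stuck (s r : word) (C : cells) (t : bool) (m n : nat) L D :
  good s r C -> reach (init s r (S m) (S n)) C L D -> stuck L D ->
  Forall (live t) L -> False.
Proof.
  intros G H S Hl. pose proof (good_lower _ _ _ G t _ _ _ _ H S) as E.
  rewrite done_live in E; [simpl in E; lia|exact Hl].
Qed.

Lemma init_split (s r : word) (m n : nat) :
  Permutation (init s r (S m) (S n)) ([(true, s); (false, r)] ++ init s r m n).
Proof.
  unfold init. simpl. apply perm_skip. symmetry. apply Permutation_middle.
Qed.

(** The finished pair stays as an inert frame: it raises both numbers by one, which keeps the
    surplus, and it supplies the one finished process of each kind by which the lower bound
    rises. *)
Lemma good_rest (s s' r : word) (C F : cells) :
  good s r C ->
  (forall m n, reach (init s r (S m) (S n)) C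
                     ((true, []) :: (false, []) :: init s' r m n) F) ->
  good s' r F.
Proof.
  intros [Hlow [B Hup]] Hpre.
  assert (ext : forall m n L D, reach (init s' r m n) F L D ->
      reach (init s r (S m) (S n)) C (L ++ [(true, []); (false, [])]) D).
  { intros m n L D H. eapply reach_trans; [apply Hpre|].
    eapply reach_perm_l with (L' := init s' r m n ++ [(true, []); (false, [])]).
    - apply (Permutation_app_comm [(true, []); (false, [])]).
    - now apply reach_frame. }
  split.
  - intros t m n L D H S. apply ext in H. apply Hlow with (t := t) in H.
    + unfold done in *. rewrite count_app in H.
      replace (count (is_done t) [(true, []); (false, [])]) with 1 in H
        by (destruct t; reflexivity).
      lia.
    + apply Forall_app. split; [exact S|]. repeat constructor.
  - exists B. intros m n L D H S. apply ext in H. apply Hup in H; [lia|].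
    apply Forall_app. split; [exact S|]. repeat constructor.
Qed.

Lemma pair_completes (s r x y : word) (C E : cells) :
  good s r C -> reach [(true, s); (false, r)] C [(true, x); (false, y)] E ->
  exists F, reach [(true, x); (false, y)] E [(true, []); (false, [])] F.
Proof.
  intros G H. destruct (reach_stuck [(true, x); (false, y)] E) as (L & F & H' & S).
  exists F. pose proof (reach_trans _ _ _ _ _ _ H H') as H1.
  pose proof (good_lower _ _ _ G true 1 1 _ _ H1 S) as E1.
  pose proof (good_lower _ _ _ G false 1 1 _ _ H1 S) as E2.
  pose proof (reach_tags _ _ _ _ H1) as P.
  eapply reach_perm_r; [exact H'|].
  destruct L as [|[a u] [|[b v] [|e L]]];
    try (apply Permutation_length in P; discriminate P).
  apply Permutation_length_2_inv in P. unfold done, count, is_done in *.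
  destruct P as [P|P]; injection P as -> ->; destruct u, v; simpl in *;
    try lia; try reflexivity. apply perm_swap.
Qed.

(* One pair is driven to the store [E], at which all the other senders can run
   through [u] without changing [E]; then the pair is completed. *)
Lemma good_strip (u s r x y : word) (C E : cells) :
  good (u ++ s) r C ->
  reach [(true, u ++ s); (false, r)] C [(true, x); (false, y)] E ->
  exec u E = Some E ->
  exists F, good s r F.
Proof.
  intros G H Hu. destruct (pair_completes _ _ _ _ _ _ G H) as [F HF].
  exists F. apply (good_rest _ _ _ _ _ G). intros m n.
  eapply reach_perm_l; [apply init_split|].
  eapply reach_trans; [apply reach_frame, H|].
  eapply reach_perm_l; [apply Permutation_app_comm|].
  unfold init at 1. rewrite <- app_assoc.
  eapply reach_trans; [apply reach_exec_clones, Hu|].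
  rewrite app_assoc.
  eapply reach_perm_l; [apply Permutation_app_comm|].
  apply (reach_frame _ _ _ _ (init s r m n)) in HF. exact HF.
Qed.

Lemma good_next (s r : word) (C F : cells) :
  good s r C ->
  reach [(true, s); (false, r)] C [(true, []); (false, [])] F ->
  good s r F.
Proof.
  intros G H. apply (good_rest _ _ _ _ _ G). intros m n.
  eapply reach_perm_l; [apply init_split|].
  apply (reach_frame _ _ _ _ (init s r m n)) in H. exact H.
Qed.

Lemma good_nonempty (r : word) (C : cells) : ~ good [] r C.
Proof.
  intros [_ [B Hup]].
  assert (S B <= 0 + B); [|lia].
  apply (Hup (S B) 0 (init [] r (S B) 0) C); [apply reach_refl|].
  unfold init. apply Forall_forall. intros e He. rewrite app_nil_r in He.
  apply repeat_spec in He. subst. reflexivity.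
Qed.

(* A single receiver is fed by ever fresh senders, each of which is left waiting
   at its second action on the lock [l]: no sender ever gets through. *)
Lemma good_no_retake (l : bool) (q s r : word) (C : cells) :
  only (negb l) q -> ~ good (Take l :: q ++ Take l :: s) r C.
Proof.
  intros Hq G. set (fresh := Take l :: q ++ Take l :: s) in *.
  set (waits := fun e : bool * word => exists w, e = (true, Take l :: w)).
  assert (waiting : forall N (K : config bool),
    Forall waits K ->
    Forall waits
           (K ++ repeat (true, fresh) N)).
  { intros N K HK. apply Forall_app. split; [exact HK|].
    apply Forall_forall. intros e He. apply repeat_spec in He. subst. eexists. reflexivity. }
  assert (halt : forall K y D, get l D = true ->
    Forall waits K ->
    blocked D (false, y) -> stuck ((false, y) :: K) D /\ Forall (live true) ((false, y) :: K)).
  { intros K y D Hl HK Hy. split; constructor; auto; try discriminate;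
      eapply Forall_impl; try exact HK; intros e [w ->];
      unfold blocked, live; simpl; [now rewrite Hl|discriminate]. }
  (* A fresh sender either reaches its second [Take l] with the other lock empty, or both locks
     become full and nothing moves any more. *)
  assert (feed : forall K y D, get l D = false ->
    Forall waits K ->
    blocked D (false, y) ->
    (exists K', reach ((true, fresh) :: K) D K' (cells_of l true true) /\
       stuck ((false, y) :: K') (cells_of l true true) /\
       Forall (live true) ((false, y) :: K')) \/
    reach ((true, fresh) :: K) D ((true, Take l :: s) :: K) (cells_of l true false)).
  { intros K y D Hl HK Hy. rewrite (cells_eta l D), Hl.
    set (b := get (negb l) D).
    assert (y_blocked : blocked (cells_of l true true) (false, y)).
    { destruct y as [|a y]; [exact I|]. unfold blocked in *; simpl in *.
      destruct a as [k|k]; simpl in *; [|discriminate].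
      destruct k, l; reflexivity. }
    assert (take : do_act (Take l) (cells_of l false b) = Some (cells_of l true b))
      by (simpl; now rewrite get_cells_of, set_cells_of).
    destruct (exec_cases q (cells_of l true b)) as [[D' HD]|(u & k & v & D' & Eq & HD & Hk)].
    - destruct (exec_only (negb l) q b true D') as (b' & -> & _);
        [exact Hq|now rewrite cells_of_negb|].
      rewrite cells_of_negb in HD.
      assert (run : reach ((true, fresh) :: K) (cells_of l false b)
                      ((true, Take l :: s) :: K) (cells_of l true b')).
      { unfold fresh. eapply reach_act; [reflexivity|exact take|]. now apply reach_exec. }
      destruct b'; [left|right; exact run].
      eexists. split; [exact run|]. apply halt; auto.
      + apply get_cells_of.
      + constructor; [now exists s|exact HK].
    - left. subst q. apply Forall_app in Hq as [Hu Hv].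
      apply Forall_inv in Hv. simpl in Hv. subst k.
      destruct (exec_only (negb l) u b true D') as (b' & -> & _);
        [exact Hu|now rewrite cells_of_negb|].
      rewrite cells_of_negb in HD. rewrite cells_of_negb, get_cells_of_other in Hk. subst b'.
      exists ((true, (Take (negb l) :: v) ++ Take l :: s) :: K). split.
      + unfold fresh. eapply reach_act; [reflexivity|exact take|].
        rewrite <- app_assoc. now apply reach_exec.
      + destruct (halt K y (cells_of l true true)) as [S HL];
          [apply get_cells_of|exact HK|exact y_blocked|].
        inversion S; inversion HL; subst.
        split; repeat (constructor; auto).
        * unfold blocked. simpl. now rewrite get_cells_of_other.
        * discriminate. }
  (* The receiver moves whenever it can. A sender is spent only when it is blocked, and afterwards
     it moves or everything is stuck; hence more senders than receiver actions suffice. *)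
  assert (main : forall y N K D, length y < N ->
    Forall waits K ->
    exists L D', reach ((false, y) :: K ++ repeat (true, fresh) N) D L D' /\
      stuck L D' /\ Forall (live true) L).
  { assert (blocked_case : forall y N K D, blocked D (false, y) -> 0 < N ->
      Forall waits K ->
      (exists L D', reach ((false, y) :: K ++ repeat (true, fresh) N) D L D' /\
        stuck L D' /\ Forall (live true) L) \/
      exists K', reach ((false, y) :: K ++ repeat (true, fresh) N) D
        ((false, y) :: K' ++ repeat (true, fresh) (N - 1)) (cells_of l true false) /\
        Forall waits K' /\ get l D = false).
    { intros y N K D Hy HN HK. destruct (get l D) eqn:Hl.
      - left. do 2 eexists. split; [apply reach_refl|]. apply halt; auto.
      - destruct N as [|N]; [lia|]. replace (S N - 1) with N by lia.
        assert (P : Permutation ((false, y) :: K ++ repeat (true, fresh) (S N))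
          (((true, fresh) :: K ++ repeat (true, fresh) N) ++ [(false, y)])).
        { simpl. rewrite <- Permutation_middle. rewrite perm_swap. apply perm_skip.
          apply Permutation_cons_append. }
        destruct (feed (K ++ repeat (true, fresh) N) y D Hl (waiting _ _ HK) Hy)
          as [(K' & H & S & HL)|H].
        + left. exists ((false, y) :: K'), (cells_of l true true). split; [|auto].
          eapply reach_perm_l; [exact P|]. eapply reach_perm_r; [apply reach_frame, H|].
          symmetry. apply Permutation_cons_append.
        + right. exists ((true, Take l :: s) :: K). split; [|split].
          * eapply reach_perm_l; [exact P|]. eapply reach_perm_r; [apply reach_frame, H|].
            symmetry. apply Permutation_cons_append.
          * constructor; [now exists s|exact HK].
          * reflexivity. }
    induction y as [|a y IH]; intros N K D HN HK.
    - destruct (blocked_case [] N K D) as [H|(K' & H & HK' & _)]; auto; [exact I|].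
      do 2 eexists. split; [exact H|]. apply halt; auto.
      + apply get_cells_of.
      + exact I.
    - simpl in HN. destruct (do_act a D) as [D1|] eqn:Ea.
      + destruct (IH N K D1) as (L & D' & H & S); [lia|exact HK|].
        exists L, D'. split; [|exact S]. eapply reach_act; [reflexivity|exact Ea|exact H].
      + destruct (blocked_case (a :: y) N K D) as [H|(K' & H & HK' & Hl)];
          auto; [lia|].
        destruct (do_act a (cells_of l true false)) as [D1|] eqn:Ea1.
        * destruct (IH (N - 1) K' D1) as (L & D' & H' & S); [lia|exact HK'|].
          exists L, D'. split; [|exact S]. eapply reach_trans; [exact H|].
          eapply reach_act; [reflexivity|exact Ea1|exact H'].
        * do 2 eexists. split; [exact H|]. apply halt; auto. apply get_cells_of. }
  destruct (main r (S (length r)) [] C) as (L & D & H & S & HL); [lia|constructor|].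
  apply (good_not_stuck _ _ _ true (length r) 0 L D G); auto.
  eapply reach_perm_l; [|exact H]. unfold init. simpl.
  symmetry. apply (Permutation_cons_append ((true, fresh) :: repeat (true, fresh) (length r))).
Qed.

Lemma good_blocked (u y r : word) (t : bool) (C D : cells) :
  good (u ++ y) r C -> exec u C = Some D ->
  stuck [(true, y); (false, r)] D -> Forall (live t) [(true, y); (false, r)] -> False.
Proof.
  intros G H. apply (good_not_stuck _ _ _ t 0 0 _ _ G). now apply reach_exec.
Qed.

(** The first sender halts before [y] and leaves the store in which the second one runs and halts
    before [y']. *)
Lemma good_blocked2 (s u y u' y' r : word) (t : bool) (C C' D : cells) :
  good s r C -> s = u ++ y -> exec u C = Some C' ->
  s = u' ++ y' -> exec u' C' = Some D ->
  stuck [(true, y'); (true, y); (false, r)] D ->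
  Forall (live t) [(true, y'); (true, y); (false, r)] -> False.
Proof.
  intros G E H E' H'. apply (good_not_stuck _ _ _ t 1 0 _ _ G). simpl.
  assert (first : forall R, reach ((true, s) :: R) C ((true, y) :: R) C')
    by (intros R; rewrite E; now apply reach_exec).
  assert (second : forall R, reach ((true, s) :: R) C' ((true, y') :: R) D)
    by (intros R; rewrite E'; now apply reach_exec).
  eapply reach_trans; [apply first|].
  eapply reach_perm_l; [apply perm_swap|]. apply second.
Qed.

(** Any number of senders could pass without a receiver, against the bound on the surplus. *)
Lemma good_no_loop (s r : word) (C : cells) : good s r C -> exec s C <> Some C.
Proof.
  intros [_ [B Hup]] H.
  assert (S B <= 0 + B); [|lia].
  apply (Hup (S B) 0 (repeat (true, []) (S B) ++ []) C).
  - unfold init. simpl repeat at 2. rewrite <- (app_nil_r s).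
    now apply reach_exec_clones.
  - apply Forall_forall. intros e He. rewrite app_nil_r in He.
    apply repeat_spec in He. subst. reflexivity.
Qed.

(** * Words whose first action takes a lock *)

Lemma exec_take (l b : bool) (w : word) :
  exec (Take l :: w) (cells_of l false b) = exec w (cells_of l true b).
Proof. simpl. now rewrite get_cells_of, set_cells_of. Qed.

Lemma full_blocked (t k : bool) (l : bool) (w : word) :
  blocked (cells_of l true true) (t, Take k :: w).
Proof. unfold blocked. simpl. destruct k, l; reflexivity. Qed.

Lemma lock_blocked (t l b : bool) (w : word) :
  blocked (cells_of l true b) (t, Take l :: w).
Proof. unfold blocked. simpl. now rewrite get_cells_of. Qed.

Ltac solve_stuck :=
  repeat apply Forall_cons; try apply Forall_nil;
  first [exact I | apply full_blocked | apply lock_blocked].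

Ltac solve_live :=
  repeat apply Forall_cons; try apply Forall_nil; unfold live; simpl; congruence.

Lemma starts_with_take_dec (k : bool) (w : word) :
  starts_with (Take k) w \/ ~ starts_with (Take k) w.
Proof.
  destruct w as [|[j|j] w].
  - right. intros [v H]. discriminate.
  - destruct (bool_dec j k) as [->|E]; [left; eexists; reflexivity|].
    right. intros [v H]. congruence.
  - right. intros [v H]. discriminate.
Qed.

(* Otherwise both locks would be full while everyone wants to take one. *)
Lemma good_exec_only (l k c : bool) (q rest w : word) :
  good (Take l :: q ++ rest) (Take k :: w) (cells_of l false c) ->
  only (negb l) q ->
  exists c', exec q (cells_of l true c) = Some (cells_of l true c').
Proof.
  intros G Hq.
  destruct (exec_cases q (cells_of l true c)) as [[D HD]|(u & j & v & D & -> & HD & Hj)].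
  - destruct (exec_only (negb l) q c true D) as (c' & -> & _);
      [exact Hq|now rewrite cells_of_negb|].
    exists c'. now rewrite cells_of_negb in HD.
  - exfalso. apply Forall_app in Hq as [Hu Hv].
    apply Forall_inv in Hv. simpl in Hv. subst j.
    destruct (exec_only (negb l) u c true D) as (c' & -> & _);
      [exact Hu|now rewrite cells_of_negb|].
    rewrite get_cells_of in Hj. subst c'. rewrite cells_of_negb in HD.
    rewrite <- app_assoc in G.
    apply (good_blocked (Take l :: u) _ _ true _ (cells_of l true true) G).
    + now rewrite exec_take.
    + solve_stuck.
    + solve_live.
Qed.

(** The sender's next action on [l] must be [Free l], or else the lock stays full while the receiver
    waits for it. The section from [Take l] to [Free l] can then be stripped off. *)
Lemma good_same_lock (l : bool) (w w' : word) (C : cells) :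
  good (Take l :: w) (Take l :: w') C ->
  get l C = false /\
  exists u s F, w = u ++ s /\ good s (Take l :: w') F.
Proof.
  intros G. rewrite (cells_eta l C) in G |- *.
  generalize dependent (get (negb l) C). intros c G.
  rewrite get_cells_of. destruct (get l C).
  { exfalso. apply (good_blocked [] _ _ true _ _ G eq_refl).
    - solve_stuck.
    - solve_live. }
  split; [reflexivity|].
  destruct (split_only l w) as (q & rest & -> & Hq & Hrest).
  destruct (good_exec_only _ _ _ _ _ _ G Hq) as [c' Hc'].
  assert (G' := G). rewrite app_comm_cons in G'.
  destruct Hrest as [->|[[v ->]|[v ->]]].
  - exfalso. apply (good_blocked _ _ _ false _ (cells_of l true c') G').
    + now rewrite exec_take.
    + solve_stuck.
    + solve_live.
  - exfalso. apply (good_blocked _ _ _ true _ (cells_of l true c') G').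
    + now rewrite exec_take.
    + solve_stuck.
    + solve_live.
  - exists (q ++ [Free l]), v. clear G'.
    replace (q ++ Free l :: v) with ((q ++ [Free l]) ++ v) in G |- *
      by (now rewrite <- app_assoc).
    assert (section : forall x x', exec q (cells_of l true x) = Some (cells_of l true x') ->
      exec (Take l :: q ++ [Free l]) (cells_of l false x) = Some (cells_of l false x')).
    { intros x x' Hx. rewrite exec_take, (exec_app _ _ _ _ Hx). simpl.
      now rewrite set_cells_of. }
    assert (strip : exec q (cells_of l true c') = Some (cells_of l true c') ->
      exists F, good v (Take l :: w') F).
    { intros Hloop. rewrite app_comm_cons in G.
      eapply good_strip; [exact G|apply reach_exec, section, Hc'|apply section, Hloop]. }
    cut (exists F, good v (Take l :: w') F); [intros [F HF]; eauto|].
    destruct (starts_with_take_dec (negb l) q) as [[q' ->]|Hstart].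
    (* Here [q] begins by taking the other lock, which is therefore empty at first. If [q] leaves it
       full, the section cannot be repeated, and stripping is replaced by a contradiction. *)
    + destruct c; [exfalso|].
      { simpl in Hc'. rewrite get_cells_of_other in Hc'. discriminate. }
      destruct c'; [exfalso|auto].
      assert (second : exec [Take l] (cells_of l false true) = Some (cells_of l true true))
        by apply exec_take.
      apply section in Hc'. clear strip section.
      set (s := Take l :: _ ++ v) in G.
      assert (E2 : s = [Take l] ++ Take (negb l) :: (q' ++ [Free l]) ++ v) by reflexivity.
      (* Wherever the first sender stops, either [l] is full and the receiver waits for it, or the
         other lock is full and a second sender waits for that one after taking [l], or the sender
         is through and has restored the empty store. *)
      destruct (exec_cases v (cells_of l false true)) as [[D HD]|(u & j & v' & D & -> & HD & Hj)].
      * assert (Hs : exec (s ++ []) (cells_of l false false) = Some D).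
        { rewrite app_nil_r. unfold s. rewrite app_comm_cons.
          now rewrite (exec_app _ _ _ _ Hc'). }
        rewrite app_nil_r in Hs.
        assert (Es : s = s ++ []) by (now rewrite app_nil_r).
        rewrite (cells_eta l D) in Hs.
        destruct (get l D) eqn:Hl; [|destruct (get (negb l) D)].
        -- rewrite Es in G. apply (good_blocked _ _ _ false _ _ G Hs).
           ++ solve_stuck.
           ++ solve_live.
        -- apply (good_blocked2 _ _ _ _ _ _ false _ _ _ G Es Hs E2 second).
           ++ solve_stuck.
           ++ solve_live.
        -- apply (good_no_loop _ _ _ G Hs).
      * assert (E1 : s = ((Take l :: ((Take (negb l) :: q') ++ [Free l])) ++ u) ++ Take j :: v')
          by (unfold s; simpl; now rewrite <- !app_assoc).
        assert (Hs : exec ((Take l :: ((Take (negb l) :: q') ++ [Free l])) ++ u)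
                       (cells_of l false false) = Some D)
          by (now rewrite (exec_app _ _ _ _ Hc')).
        rewrite (cells_eta l D) in Hs.
        destruct (get l D) eqn:Hl.
        -- rewrite E1 in G. apply (good_blocked _ _ _ true _ _ G Hs).
           ++ apply Forall_cons; [|solve_stuck].
              unfold blocked. simpl. rewrite <- Hl, <- cells_eta, Hj. reflexivity.
           ++ solve_live.
        -- destruct (bool_dec j l) as [->|Ej]; [congruence|].
           assert (j = negb l) as -> by (destruct j, l; simpl; congruence).
           rewrite Hj in Hs.
           apply (good_blocked2 _ _ _ _ _ _ true _ _ _ G E1 Hs E2 second).
           ++ solve_stuck.
           ++ solve_live.
    (* As [q] does not begin by taking the other lock, a second run of it changes nothing. *)
    + apply strip.
      destruct (exec_only_any (negb l) q c true c true (cells_of l true c'))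
        as (x & Hx & Hx'); [exact Hq|exact Hstart|now rewrite cells_of_negb|].
      specialize (Hx' true). rewrite 2!cells_of_negb in Hx. rewrite !cells_of_negb in Hx'.
      rewrite Hc' in Hx. injection Hx as Hx.
      assert (c' = x) as -> by (destruct l; simpl in Hx; congruence).
      exact Hx'.
Qed.

(* The one shape that survives: a message in a one-place buffer is encoded by
   which of the two locks is full. *)
Definition buffer (s r : word) (l : bool) : Prop :=
  exec s (cells_of l false true) = Some (cells_of l true false) /\
  exec r (cells_of l true false) = Some (cells_of l false true).

Lemma buffer_sym (s r : word) (l : bool) : buffer s r l -> buffer r s (negb l).
Proof. unfold buffer. rewrite !cells_of_negb. tauto. Qed.

(** Freeing [l] changes nothing at the sender's start; freeing the other lock only makes the store
    emptier. *)
Lemma buffer_free (s r : word) (k l : bool) : buffer s r l -> buffer (Free k :: s) r l.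
Proof.
  intros [Hs Hr]. split; [|exact Hr]. simpl.
  destruct (bool_dec k l) as [->|E].
  - now rewrite set_cells_of.
  - assert (k = negb l) as -> by (destruct k, l; simpl; congruence).
    rewrite set_cells_of_other. now apply exec_swap_emptier.
Qed.

Lemma buffer_take (s w : word) (k l : bool) : buffer s (Take k :: w) l -> k = negb l.
Proof.
  intros [_ H]. destruct k, l; simpl in *; congruence.
Qed.

(** Were the other lock full at the end, the receiver could not begin. *)
Lemma good_pass (l c : bool) (q w : word) :
  good (Take l :: q) (Take (negb l) :: w) (cells_of l false c) ->
  only (negb l) q ->
  exec (Take l :: q) (cells_of l false c) = Some (cells_of l true false).
Proof.
  intros G Hq. rewrite <- (app_nil_r q) in G.
  destruct (good_exec_only _ _ _ _ _ _ G Hq) as [[] Hc].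
  - exfalso. rewrite app_comm_cons in G.
    apply (good_blocked _ _ _ false _ (cells_of l true true) G).
    + now rewrite exec_take.
    + solve_stuck.
    + solve_live.
  - now rewrite exec_take.
Qed.

(** Cases on the sender's next action on [l]: a second take is excluded by [good_no_retake], and a
    release closes a section that can be stripped off for the induction. If there is none, the
    sender leaves only [l] full, and the receiver is analysed likewise. *)
Lemma good_distinct_locks (l : bool) (w w' : word) (c : bool) :
  good (Take l :: w) (Take (negb l) :: w') (cells_of l false c) ->
  ~ starts_with (Take (negb l)) w ->
  (forall s r F, length s + length r < length (Take l :: w) + length (Take (negb l) :: w') ->
     good s r F -> exists k, buffer s r k) ->
  exists k, buffer (Take l :: w) (Take (negb l) :: w') k.
Proof.
  intros G Hw IH.
  destruct (split_only l w) as (q & rest & -> & Hq & Hrest).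
  assert (Hstart : ~ starts_with (Take (negb l)) q).
  { intros [v ->]. apply Hw. eexists. reflexivity. }
  destruct (good_exec_only _ _ _ _ _ _ G Hq) as [c' Hc'].
  destruct Hrest as [->|[[v ->]|[v ->]]].
  - rewrite app_nil_r in *. clear Hc'. exists l.
    assert (Hs := good_pass _ _ _ _ G Hq).
    destruct (split_only (negb l) w') as (p & rest & -> & Hp & Hrest).
    rewrite negb_involutive in Hp.
    (* The sender is through, so a receiver that finds both locks full before a [Take] would wait
       forever. *)
    assert (alone : forall u y b, p ++ rest = u ++ Take b :: y ->
      exec u (cells_of l true true) <> Some (cells_of l true true)).
    { intros u y b E Hu.
      apply (good_not_stuck _ _ _ false 0 0 [(false, Take b :: y); (true, [])]
               (cells_of l true true) G).
      - eapply reach_trans; [apply reach_exec_all, Hs|].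
        eapply reach_perm_l; [apply perm_swap|].
        rewrite E, app_comm_cons. apply reach_exec.
        rewrite <- cells_of_negb, exec_take, cells_of_negb. exact Hu.
      - solve_stuck.
      - solve_live. }
    assert (exists z, exec p (cells_of l true true) = Some (cells_of l z true)) as [z Hz].
    { destruct (exec_cases p (cells_of l true true)) as [[D HD]|(u & j & v & D & -> & HD & Hj)].
      - destruct (exec_only l p _ _ D Hp HD) as (z & -> & _). eauto.
      - exfalso. apply Forall_app in Hp as [Hu Hv].
        apply Forall_inv in Hv. simpl in Hv. subst j.
        destruct (exec_only l u _ _ D Hu HD) as (z & -> & _).
        rewrite get_cells_of in Hj. subst z.
        apply (alone u (v ++ rest) l); [now rewrite <- app_assoc|exact HD]. }
    assert (Hr : exec (Take (negb l) :: p) (cells_of l true false) = Some (cells_of l z true))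
      by (now rewrite <- cells_of_negb, exec_take, cells_of_negb).
    assert (Hpstart : ~ starts_with (Take l) p).
    { intros [v ->]. apply (alone [] (v ++ rest) l); reflexivity. }
    destruct Hrest as [->|[[v ->]|[v ->]]].
    + rewrite app_nil_r in *.
      (* The store after one completed pair is again good and cannot be full; so only the other lock
         is full there, which is where the buffer condition on the sender starts. *)
      assert (G' : good (Take l :: q) (Take (negb l) :: p) (cells_of l z true)).
      { apply (good_next _ _ _ _ G).
        eapply reach_trans; [apply reach_exec_all, Hs|].
        eapply reach_perm_l; [apply perm_swap|].
        eapply reach_perm_r; [|apply perm_swap]. apply reach_exec_all, Hr. }
      destruct z.
      { exfalso. apply (good_blocked [] _ _ true _ _ G' eq_refl).
        - solve_stuck.
        - solve_live. }
      split; [|exact Hr]. exact (good_pass _ _ _ _ G' Hq).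
    + exfalso. apply good_sym in G. revert G. apply good_no_retake.
      now rewrite negb_involutive.
    + set (u := Take (negb l) :: p ++ [Free (negb l)]).
      assert (section : forall x x', exec p (cells_of l x true) = Some (cells_of l x' true) ->
        exec u (cells_of l x false) = Some (cells_of l x' false)).
      { intros x x' Hx. unfold u. rewrite <- cells_of_negb, exec_take, cells_of_negb.
        rewrite (exec_app _ _ _ _ Hx). simpl. now rewrite set_cells_of_other. }
      destruct (exec_only_any l p true true true true _ Hp Hpstart Hz) as (x & Hx & Hxx).
      assert (Ew : Take (negb l) :: p ++ Free (negb l) :: v = u ++ v)
        by (unfold u; simpl; now rewrite <- app_assoc).
      rewrite Ew in G |- *. apply good_sym in G.
      apply section in Hx. specialize (section _ _ (Hxx true)).
      destruct (good_strip u v (Take l :: q) v [] _ (cells_of l x false) G)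
        as [F HF]; [|exact section|].
      { eapply reach_perm_l; [apply perm_swap|].
        eapply reach_trans; [apply reach_exec_all, Hs|].
        eapply reach_perm_l; [apply perm_swap|]. now apply reach_exec. }
      destruct (IH v (Take l :: q) F) as [k Hk]; [|exact HF|].
      { unfold u. simpl. rewrite !length_app. simpl. lia. }
      assert (k = negb l) as ->
        by (rewrite (buffer_take _ _ _ _ Hk), negb_involutive; reflexivity).
      destruct Hk as [Hv Hs']. rewrite !cells_of_negb in Hs'.
      (* The section may leave [l] emptier than in the store at which [v] is known to swap. *)
      split; [exact Hs'|]. rewrite (exec_app _ _ _ _ Hx).
      rewrite <- (cells_of_negb l false x), <- (cells_of_negb l true false).
      now apply exec_swap_emptier.
  - exfalso. revert G. now apply good_no_retake.
  - exists l.
    set (u := Take l :: q ++ [Free l]).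
    assert (section : forall x x', exec q (cells_of l true x) = Some (cells_of l true x') ->
      exec u (cells_of l false x) = Some (cells_of l false x')).
    { intros x x' Hx. unfold u. rewrite exec_take, (exec_app _ _ _ _ Hx). simpl.
      now rewrite set_cells_of. }
    assert (Ew : Take l :: q ++ Free l :: v = u ++ v)
      by (unfold u; simpl; now rewrite <- app_assoc).
    assert (any : forall x, exists x', exec u (cells_of l false x) = Some (cells_of l false x') /\
      exec u (cells_of l false x') = Some (cells_of l false x')).
    { intros x. destruct (exec_only_any (negb l) q c true x true (cells_of l true c'))
        as (x' & Hx & Hx'); [exact Hq|exact Hstart|now rewrite cells_of_negb|].
      specialize (Hx' true). rewrite 2!cells_of_negb in Hx. rewrite !cells_of_negb in Hx'.
      exists x'. auto. }
    rewrite Ew in *.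
    destruct (any c) as (x & Hx & Hxx).
    destruct (good_strip u v _ v _ _ _ G (reach_exec _ _ _ _ _ _ Hx) Hxx) as [F HF].
    destruct (IH v (Take (negb l) :: w') F) as [k Hk]; [|exact HF|].
    { unfold u. simpl. rewrite !length_app. simpl. lia. }
    assert (k = l) as ->
      by (apply buffer_take in Hk; destruct k, l; simpl in *; congruence).
    destruct Hk as [Hv Hr]. split; [|exact Hr].
    destruct (any true) as (x1 & Hx1 & _).
    rewrite (exec_app _ _ _ _ Hx1). now apply exec_swap_emptier.
Qed.

(** Once a sender has freed [k], a further [Free k] leaves the store unchanged. *)
Lemma good_free (k : bool) (s r : word) (C : cells) :
  good (Free k :: s) r C -> exists F, good s r F.
Proof.
  intros G.
  assert (H : forall D, exec [Free k] D = Some (set k false D)) by reflexivity.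
  apply (good_strip [Free k] s r s r C (set k false C)); [exact G| |].
  - apply (reach_exec true [Free k]), H.
  - rewrite H. f_equal. destruct C, k; reflexivity.
Qed.

(** Induction on the total length: a leading [Free] is stripped from either word; then both begin
    with a take, of the same lock or of different ones. *)
Lemma good_buffer (s r : word) (C : cells) : good s r C -> exists l, buffer s r l.
Proof.
  remember (length s + length r) as n eqn:En. revert s r C En.
  induction n as [n IH] using lt_wf_ind. intros s r C -> G.
  destruct s as [|[k|k] s].
  { destruct (good_nonempty _ _ G). }
  2: { destruct (good_free _ _ _ _ G) as [F HF].
       destruct (IH (length s + length r)) with (3 := HF) as [l Hl];
         [simpl; lia|reflexivity|].
       exists l. now apply buffer_free. }
  destruct r as [|[j|j] r].
  { apply good_sym in G. destruct (good_nonempty _ _ G). }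
  2: { apply good_sym in G. destruct (good_free _ _ _ _ G) as [F HF].
       apply good_sym in HF.
       destruct (IH (length (Take k :: s) + length r)) with (3 := HF) as [l Hl];
         [simpl; lia|reflexivity|].
       exists l. rewrite <- (negb_involutive l).
       apply buffer_sym, buffer_free, buffer_sym, Hl. }
  destruct (bool_dec j k) as [->|Ejk].
  (* The same lock is impossible: by the buffer shape of the shortened pair, the receiver passes
     alone from [C] and leaves [k] full, so no sender can begin. *)
  - destruct (good_same_lock _ _ _ _ G) as [HC (u & v & F & -> & HF)].
    destruct (IH (length v + length (Take k :: r))) with (3 := HF) as [l Hl];
      [simpl; rewrite length_app; lia|reflexivity|].
    assert (Hk := buffer_take _ _ _ _ Hl). destruct Hl as [_ Hr].
    assert (l = negb k) as -> by (now rewrite Hk, negb_involutive).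
    rewrite !cells_of_negb in Hr.
    rewrite (cells_eta k C), HC in G.
    apply (exec_swap_emptier _ _ (get (negb k) C)) in Hr.
    exfalso. apply good_sym in G. rewrite <- (app_nil_r (Take k :: r)) in G.
    apply (good_blocked _ _ _ false _ _ G Hr); [solve_stuck|solve_live].
  - assert (j = negb k) as -> by (destruct j, k; simpl; congruence). clear Ejk.
    assert (G' := good_sym _ _ _ G).
    assert (IH' : forall s' r' F,
      length s' + length r' < length (Take k :: s) + length (Take (negb k) :: r) ->
      good s' r' F -> exists l, buffer s' r' l) by eauto.
    (* With the roles interchanged, [good_distinct_locks] applies when the lock that the receiver
       takes first is empty. *)
    assert (swap_case : forall b, C = cells_of k b false -> ~ starts_with (Take k) r ->
      exists l, buffer (Take k :: s) (Take (negb k) :: r) l).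
    { intros b -> Hr. pose proof (good_distinct_locks (negb k) r s b) as H.
      rewrite cells_of_negb, negb_involutive in H.
      destruct (H G' Hr) as [l Hl].
      - intros s' r' F Hlen. apply IH'. lia.
      - exists (negb l). now apply buffer_sym. }
    rewrite (cells_eta k C) in G, swap_case.
    destruct (get k C), (get (negb k) C).
    + exfalso. apply (good_blocked [] _ _ true _ _ G eq_refl); [solve_stuck|solve_live].
    + apply (swap_case true); [reflexivity|]. intros [v ->].
      apply good_sym in G.
      apply (good_blocked [Take (negb k)] _ _ true _ (cells_of k true true) G);
        [|solve_stuck|solve_live].
      rewrite <- cells_of_negb, exec_take, cells_of_negb. reflexivity.
    + apply (good_distinct_locks _ _ _ _ G); [|exact IH']. intros [v ->].
      apply (good_blocked [Take k] _ _ true _ (cells_of k true true) G);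
        [|solve_stuck|solve_live].
      now rewrite exec_take.
    + destruct (starts_with_take_dec (negb k) s) as [[v ->]|Hs];
        [|now apply (good_distinct_locks _ _ _ _ G)].
      (* Otherwise both words would begin by taking both locks, in opposite orders: the classical
         deadlock. *)
      apply (swap_case false); [reflexivity|]. intros [v' ->].
      apply (good_not_stuck _ _ _ true 0 0
               [(false, Take k :: v'); (true, Take (negb k) :: v)] (cells_of k true true) G);
        [|solve_stuck|solve_live].
      eapply reach_trans; [apply (reach_exec true [Take k])|].
      * now rewrite exec_take.
      * eapply reach_perm_l; [apply perm_swap|].
        apply (reach_exec false [Take (negb k)]).
        rewrite <- cells_of_negb, exec_take, cells_of_negb. reflexivity.
Qed.

(** * Buffers against the initial store *)

Definition no_double (s r : word) (C : cells) : Prop :=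
  forall L D, reach [(SZero, s); (SCheck, r ++ r)] C L D -> ~ In (SCheck, []) L.

(** [no_double s r] mirrors [!0 | ??✓]. After the leading [Free k], either the sender passes alone,
    or only [l] is full; then the receiver, the rest of the sender and the receiver again pass in
    turn. *)
Lemma good_free_full (k : bool) (s r : word) :
  good (Free k :: s) r (true, true) ->
  (forall D, exec (Free k :: s) (true, true) <> Some D) ->
  no_double (Free k :: s) r (true, true) -> False.
Proof.
  intros G Hs Hsr. destruct (good_free _ _ _ _ G) as [F HF].
  destruct (good_buffer _ _ _ HF) as [l [Hs' Hr]].
  replace (true, true) with (cells_of l true true) in Hs, Hsr by (destruct l; reflexivity).
  simpl in Hs. destruct (bool_dec k l) as [->|E].
  - rewrite set_cells_of in Hs. exact (Hs _ Hs').
  - assert (k = negb l) as -> by (destruct k, l; simpl; congruence). clear E.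
    apply (Hsr [(SCheck, []); (SZero, [])] (cells_of l false true)); [|now left].
    eapply reach_trans; [apply (reach_exec SZero [Free (negb l)])|].
    { simpl. now rewrite set_cells_of_other. }
    eapply reach_perm_l; [apply perm_swap|].
    eapply reach_trans; [apply reach_exec, Hr|].
    eapply reach_perm_l; [apply perm_swap|].
    eapply reach_trans; [apply reach_exec_all, Hs'|].
    eapply reach_perm_l; [apply perm_swap|].
    apply reach_exec_all, Hr.
Qed.

(** Where [l] is empty, [s] passes alone; where only [l] is full, [r] does. At the full store an
    empty word passes alone and two leading takes deadlock, so some word begins with [Free]. *)
Lemma good_absurd (s r : word) (C : cells) :
  good s r C ->
  (forall D, exec s C <> Some D) -> (forall D, exec r C <> Some D) ->
  no_double s r C -> no_double r s C -> False.
Proof.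
  intros G Hs Hr Hsr Hrs. destruct (good_buffer _ _ _ G) as [l [Bs Br]].
  destruct (get l C) eqn:El; [destruct (get (negb l) C) eqn:En|].
  - assert (C = (true, true)) as ->
      by (rewrite (cells_eta l C), El, En; destruct l; reflexivity).
    destruct s as [|[k|k] s]; [exact (Hs _ eq_refl)| |exact (good_free_full _ _ _ G Hs Hsr)].
    apply good_sym in G.
    destruct r as [|[j|j] r]; [exact (Hr _ eq_refl)| |exact (good_free_full _ _ _ G Hr Hrs)].
    apply (good_blocked [] _ _ true _ _ G eq_refl); [|solve_live].
    change (true, true) with (cells_of true true true). solve_stuck.
  - apply (Hr (cells_of l false true)). rewrite (cells_eta l C), El, En.
    rewrite <- (cells_of_negb l false true), <- (cells_of_negb l true false) in Br.
    rewrite <- (cells_of_negb l false true), <- (cells_of_negb l true false).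
    exact Br.
  - apply (Hs (cells_of l true false)). rewrite (cells_eta l C), El.
    now apply exec_swap_emptier.
Qed.

(** * Encoding into the lock calculus *)

Definition idx (l : bool) : nat := if l then 1 else 0.

Definition to_lact (a : act) : lact :=
  match a with Take l => LP (idx l) | Free l => LT (idx l) end.

Definition translate (w : word) : list lact := map to_lact w.

Lemma word_ok_translate (w : list lact) :
  word_ok 2 w -> exists w', w = translate w'.
Proof.
  induction w as [|a w IH]; intros H; [now exists []|].
  destruct IH as [w' ->]; [intros b Hb; apply H; now right|].
  assert (exists b, a = to_lact b) as [b ->]; [|now exists (b :: w')].
  specialize (H a (or_introl eq_refl)).
  destruct a as [[|[|i]]|[|[|i]]]; simpl in H; try lia.
  - now exists (Take false).
  - now exists (Take true).
  - now exists (Free false).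
  - now exists (Free true).
Qed.

(** Stores are functions on all numbers; comparing the two relevant values avoids equality of
    functions. *)
Definition agrees (C : store) (D : cells) : Prop := forall l, C (idx l) = get l D.

Definition to_LU (e : LU * word) : LU := prefix (translate (snd e)) (fst e).

Lemma reach_star (L L' : config LU) (D D' : cells) :
  reach L D L' D' -> forall X C, Permutation X (map to_LU L) -> agrees C D ->
  exists X' C', star lred (X, C) (X', C') /\
    Permutation X' (map to_LU L') /\ agrees C' D'.
Proof.
  induction 1 as [L L' D P|x a w R L D D1 L' D' P E _ IH]; intros X C PX HC.
  - exists X, C. split; [constructor|]. split; [|exact HC].
    rewrite PX. now apply Permutation_map.
  - set (C1 := upd C (idx (lock a)) (match a with Take _ => true | Free _ => false end)).
    destruct (IH (map to_LU ((x, w) :: R)) C1) as (X' & C' & S & PX' & HC');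
      [reflexivity| |].
    + intros l. rewrite (get_do_act _ _ _ l E). unfold C1, upd.
      rewrite <- (HC l). destruct (lock a), l; reflexivity.
    + exists X', C'. split; [|auto]. eapply star_step; [|exact S].
      exists (to_lact a), (to_LU (x, w)), (map to_LU R). split; [|split].
      * simpl. rewrite PX, (Permutation_map to_LU P). reflexivity.
      * reflexivity.
      * destruct a as [l|l]; simpl in *; [|reflexivity]. split; [|reflexivity].
        rewrite HC. destruct (get l D); [discriminate|reflexivity].
Qed.

Definition comm (t : bool) (U : SU) : SU := if t then SSend U else SRecv U.

(** * Processes that must converge *)

Definition mark (c : bool) : SU := if c then SCheck else SZero.

Definition offers (t c : bool) (U : SU) : bool :=
  match U with
  | SSend SCheck => t && c
  | SSend SZero => t && negb c
  | SRecv SCheck => negb t && c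
  | SRecv SZero => negb t && negb c
  | _ => false
  end.

Definition simple (U : SU) : Prop := U = SZero \/ exists t c, U = comm t (mark c).

(** A communication that involves a check succeeds; any other removes one offer with [SZero] of each
    kind and keeps the strict inequality. So an offer of kind [t] with a check never runs out of
    partners. *)
Definition balanced (t : bool) (P : SProc) : Prop :=
  Forall simple P /\
  count (offers t false) P < count (offers (negb t) false) P /\
  0 < count (offers t true) P /\
  count (offers (negb t) true) P = 0.

Lemma offers_comm (t c t' c' : bool) :
  offers t c (comm t' (mark c')) = eqb t t' && eqb c c'.
Proof. destruct t, c, t', c'; reflexivity. Qed.

Lemma offers_inv (t c : bool) (U : SU) : offers t c U = true -> U = comm t (mark c).
Proof.
  destruct U as [| |[]|[]]; simpl; try discriminate;
    destruct t, c; try discriminate; reflexivity.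
Qed.

Lemma count_pos {A : Type} (f : A -> bool) (l : list A) :
  0 < count f l -> exists x R, Permutation l (x :: R) /\ f x = true.
Proof.
  induction l as [|y l IH]; [unfold count; simpl; lia|].
  rewrite count_cons. destruct (f y) eqn:E; intros H.
  - exists y, l. auto.
  - destruct (IH H) as (x & R & P & Hx). exists x, (y :: R). split; [|exact Hx].
    rewrite P. apply perm_swap.
Qed.

Lemma balanced_step (t : bool) (P Q : SProc) :
  balanced t P -> sred P Q -> In SCheck Q \/ balanced t Q.
Proof.
  intros (HS & H1 & H2 & H3) (U1 & U2 & R & PP & PQ).
  rewrite PP in HS.
  apply Forall_cons_iff in HS as [S1 HS]. apply Forall_cons_iff in HS as [S2 HS].
  destruct S1 as [S1|(t1 & c1 & S1)]; [discriminate|].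
  destruct S2 as [S2|(t2 & c2 & S2)]; [discriminate|].
  destruct t1; [injection S1 as ->|discriminate].
  destruct t2; [discriminate|injection S2 as ->].
  destruct c1; [left; rewrite PQ; now left|].
  destruct c2; [left; rewrite PQ; right; now left|].
  right. rewrite !(count_perm _ _ _ PP) in *. clear PP.
  split; [rewrite PQ; repeat (constructor; [now left|]); exact HS|].
  rewrite !(count_perm _ _ _ PQ). rewrite !count_cons in *.
  destruct t; simpl in *; lia.
Qed.

Lemma balanced_may (t : bool) (P : SProc) : balanced t P -> s_may P.
Proof.
  intros (_ & H1 & H2 & _).
  destruct (count_pos _ _ H2) as (x & R & P1 & Hx). apply offers_inv in Hx as ->.
  assert (H3 : 0 < count (offers (negb t) false) R).
  { rewrite !(count_perm _ _ _ P1), !count_cons in H1.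
    destruct t; simpl in *; lia. }
  destruct (count_pos _ _ H3) as (y & R' & P2 & Hy). apply offers_inv in Hy as ->.
  exists (SCheck :: SZero :: R'). split; [|now left].
  eapply star_step; [|constructor].
  destruct t; simpl in *.
  - exists SCheck, SZero, R'. split; [|reflexivity]. now rewrite P1, P2.
  - exists SZero, SCheck, R'. split; [rewrite P1, P2|]; apply perm_swap.
Qed.

Lemma balanced_must (t : bool) (P : SProc) : balanced t P -> s_must P.
Proof.
  intros H Q HQ.
  assert (H' : In SCheck P \/ balanced t P) by auto. clear H.
  induction HQ as [P|P P' Q Hs _ IH].
  - destruct H' as [H|H].
    + exists P. split; [constructor|exact H].
    + eapply balanced_may, H.
  - apply IH. destruct H' as [H|H]; [left|now apply (balanced_step t P)].
    destruct Hs as (U1 & U2 & R & PP & PQ).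
    rewrite PP in H. rewrite PQ.
    destruct H as [H|[H|H]]; [discriminate|discriminate|right; right; exact H].
Qed.

(** * Processes that may not converge *)

Fixpoint comms (t : bool) (U : SU) : nat :=
  match U with
  | SSend V => (if t then 1 else 0) + comms t V
  | SRecv V => (if t then 0 else 1) + comms t V
  | _ => 0
  end.

Fixpoint has_check (U : SU) : bool :=
  match U with
  | SCheck => true
  | SZero => false
  | SSend V | SRecv V => has_check V
  end.

(* Every communication uses up one offer of kind [t]. *)
Definition short_of (t : bool) (P : SProc) : Prop :=
  forall U, In U P -> has_check U = true ->
    list_sum (map (comms t) P) < comms true U + comms false U.

(** A communication lowers the number of offers of kind [t] by exactly one, and the length of a
    subprocess by at most one. *)
Lemma short_of_step (t : bool) (P Q : SProc) :
  short_of t P -> sred P Q -> short_of t Q.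
Proof.
  intros H (U1 & U2 & R & PP & PQ) U HU Hc.
  assert (E : list_sum (map (comms t) P) = S (list_sum (map (comms t) Q))).
  { rewrite (Permutation_list_sum (Permutation_map (comms t) PP)).
    rewrite (Permutation_list_sum (Permutation_map (comms t) PQ)).
    simpl. destruct t; lia. }
  rewrite PQ in HU.
  assert (B : exists V, In V P /\ has_check V = true /\
    comms true V + comms false V <= S (comms true U + comms false U)).
  { destruct HU as [->|[->|HU]].
    - exists (SSend U). split; [rewrite PP; now left|]. simpl. split; [auto|lia].
    - exists (SRecv U). split; [rewrite PP; right; now left|]. simpl. split; [auto|lia].
    - exists U. split; [rewrite PP; right; now right|]. split; [auto|lia]. }
  destruct B as (V & HV & HcV & Hle). specialize (H V HV HcV). lia.
Qed.

Lemma short_of_not_may (t : bool) (P : SProc) : short_of t P -> ~ s_may P.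
Proof.
  intros H (Q & HQ & HS). induction HQ as [P|P P' Q Hs _ IH].
  - specialize (H _ HS eq_refl). simpl in H. lia.
  - apply IH; [|exact HS]. now apply (short_of_step t P).
Qed.

(** * Consequences of correctness *)

Section Correct.
Context (IS : store) (s r : word) (C : cells).
Context (correct : correct_translation IS (translate s) (translate r)).
Context (IS_agrees : agrees IS C).

Let role (t : bool) : word := if t then s else r.

Let tau : SU -> LU := tauU (translate s) (translate r).

Lemma tau_comm (t : bool) (U : SU) : tau (comm t U) = to_LU (tau U, role t).
Proof. destruct t; reflexivity. Qed.

(** Like [init], but parametrised by the kind that comes first, so that one proof serves both
    kinds. *)
Definition crowd (t : bool) (m n : nat) : config bool :=
  repeat (t, role t) m ++ repeat (negb t, role (negb t)) n.

Lemma crowd_init (t : bool) (m n : nat) :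
  Permutation (crowd t m n) (if t then init s r m n else init s r n m).
Proof. destruct t; [reflexivity|apply Permutation_app_comm]. Qed.

(* In a stuck state, give the continuation [SCheck] to the unfinished processes
   of kind [t] and [SZero] to all others. *)
Lemma correct_lower (t : bool) (m n : nat) (L : config bool) (D : cells) :
  reach (crowd t m n) C L D -> stuck L D -> min m n <= done t L.
Proof.
  intros H S. destruct (le_lt_dec (min m n) (done t L)) as [|Hlt]; [assumption|exfalso].
  set (label := fun e : bool * word => mark (eqb (fst e) t && negb (is_done t e))).
  set (L1 := map (fun e => ((fst e, label e), snd e)) L).
  assert (EL : Permutation L (map (fun e => (fst (fst e), snd e)) L1)).
  { unfold L1. rewrite map_map. simpl. rewrite (map_ext _ (fun e => e)), map_id;
      [reflexivity|]. intros []; reflexivity. }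
  destruct (reach_lift fst _ _ _ _ _ H EL) as (L0 & PL0 & H0).
  set (P := map (fun e => comm (fst e) (label e)) L).
  set (erase := fun p : bool * SU => tau (snd p)).
  assert (PP : Permutation (map tau P) (map to_LU (map (fun e => (erase (fst e), snd e)) L0))).
  { assert (Hrole : Forall (fun e => snd e = role (fst (fst e))) L0).
    { assert (Hc : Forall (fun e => snd e = role (fst e)) (crowd t m n)).
      { apply Forall_app. split; apply Forall_forall; intros e He;
          apply repeat_spec in He; subst; reflexivity. }
      rewrite PL0 in Hc. apply Forall_map in Hc. exact Hc. }
    assert (E0 : map to_LU (map (fun e => (erase (fst e), snd e)) L0)
               = map (fun p => tau (comm (fst p) (snd p))) (map fst L0)).
    { rewrite !map_map. apply map_ext_in. intros [[t' U] w] He.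
      rewrite Forall_forall in Hrole. apply Hrole in He. simpl in *. subst w.
      now rewrite tau_comm. }
    rewrite E0, (Permutation_map _ (reach_tags _ _ _ _ H0)).
    unfold P, L1. rewrite !map_map. reflexivity. }
  (* Fewer than [min m n] processes of kind [t] are finished: less than [m], so some carry a check;
     less than [n], so their offers with [SZero] are outnumbered. *)
  assert (Hb : balanced t P).
  { assert (Htags : forall b, count (fun e => eqb (fst e) b) L
                            = count (fun e => eqb (fst e) b) (crowd t m n)).
    { intros b. rewrite <- !(count_map (fun x => eqb x b) fst).
      apply count_perm. symmetry. exact (reach_tags _ _ _ _ H). }
    assert (Hm := Htags t). assert (Hn := Htags (negb t)).
    unfold crowd in Hm, Hn. rewrite count_app, !count_repeat in Hm, Hn. simpl in Hm, Hn.
    rewrite !eqb_reflx in Hm, Hn.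
    replace (eqb t (negb t)) with false in Hn by (destruct t; reflexivity).
    replace (eqb (negb t) t) with false in Hm by (destruct t; reflexivity).
    assert (Hcounts :
      count (offers t false) P = done t L /\
      count (offers t true) P + done t L = count (fun e => eqb (fst e) t) L /\
      count (offers (negb t) false) P = count (fun e => eqb (fst e) (negb t)) L /\
      count (offers (negb t) true) P = 0).
    { unfold P, done. rewrite !count_map. clear. unfold label.
      induction L as [|[b w] L IH]; [repeat split|]. rewrite !count_cons, !offers_comm.
      unfold is_done in *. simpl fst in *. simpl snd in *.
      destruct t, b, w; simpl in *; lia. }
    destruct Hcounts as (K1 & K2 & K3 & K4). rewrite Hm in K2. rewrite Hn in K3.
    split; [|rewrite K1, K3, K4; lia].
    unfold P. apply Forall_map, Forall_forall. intros e _. right.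
    unfold label. eauto. }
  apply balanced_must in Hb. apply (proj2 (correct P)) in Hb.
  apply (reach_map erase) in H0.
  destruct (reach_star _ _ _ _ H0 _ _ PP IS_agrees) as (X & C' & HX & PX & HC').
  destruct (Hb _ HX) as (Z & HZ & Hsucc).
  unfold L1 in PX. rewrite !map_map in PX. simpl in PX.
  unfold stuck in S. rewrite Forall_forall in S.
  (* No check is exposed, since finished processes carry [SZero], and any step would also be
     possible in the stuck [L]. *)
  inversion HZ as [|? Y ? Hstep]; subst; clear HZ.
  - unfold l_successful in Hsucc. simpl in Hsucc. rewrite PX in Hsucc.
    apply in_map_iff in Hsucc as ([b w] & E & _).
    unfold to_LU, label, is_done in E. simpl in E.
    destruct w as [|a w]; [|discriminate]. simpl in E.
    destruct (eqb b t); discriminate.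
  - destruct Hstep as (a & u & R & PR & _ & Ha). simpl in PR, Ha.
    rewrite PX in PR.
    assert (Hin : In (LAct a u) (LAct a u :: R)) by now left.
    rewrite <- PR in Hin. apply in_map_iff in Hin as ([b w] & E & Hin).
    apply S in Hin. unfold to_LU, label, is_done, blocked in *. simpl in *.
    destruct w as [|a' w]; simpl in *.
    + destruct (eqb b t); discriminate.
    + injection E as <- _. destruct a' as [l|l]; simpl in *; [|discriminate].
      rewrite HC' in Ha. destruct Ha as [Ha _]. rewrite Ha in Hin. discriminate.
Qed.

Definition iterate (n : nat) (w : word) : word := concat (repeat w n).

(** In the source only [m] offers of kind [t] face a chain of [m + 1] communications, so its check
    is never reached. *)
Lemma correct_not_through (t : bool) (m n : nat) L D :
  reach (repeat (SZero, role t) m ++ repeat (SZero, role (negb t)) n ++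
         [(SCheck, iterate (S m) (role (negb t)))]) C L D ->
  ~ In (SCheck, []) L.
Proof.
  intros H Hin.
  set (P := repeat (comm t SZero) m ++ repeat (comm (negb t) SZero) n ++
            [Nat.iter (S m) (comm (negb t)) SCheck]).
  assert (Hchain : forall k b, comms b (Nat.iter k (comm (negb t)) SCheck)
                             = if eqb b t then 0 else k).
  { induction k as [|k IH]; intros b; simpl; [destruct (eqb b t); reflexivity|].
    destruct t; simpl; rewrite IH; destruct b; reflexivity. }
  apply (short_of_not_may t P).
  { intros U HU Hc.
    assert (HU' : U = Nat.iter (S m) (comm (negb t)) SCheck).
    { apply in_app_or in HU as [HU|HU]; [|apply in_app_or in HU as [HU|[HU|[]]]];
        try (apply repeat_spec in HU; subst; destruct t; discriminate).
      symmetry. exact HU. }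
    subst U. rewrite !Hchain. unfold P.
    rewrite !map_app, !list_sum_app, !map_repeat.
    assert (Hsum : forall x k, list_sum (repeat x k) = k * x)
      by (intros x k; induction k; simpl; lia).
    rewrite !Hsum. cbn [map list_sum fold_right]. rewrite Hchain, eqb_reflx.
    destruct t; simpl; lia. }
  apply (proj1 (correct P)).
  apply (reach_map tau) in H.
  destruct (reach_star _ _ _ _ H (tauP (translate s) (translate r) P) IS)
    as (X & C' & HX & PX & _); [|exact IS_agrees|].
  - assert (E : tau (Nat.iter (S m) (comm (negb t)) SCheck)
              = to_LU (LCheck, iterate (S m) (role (negb t)))).
    { generalize (S m). induction n0 as [|k IH]; [reflexivity|].
      simpl Nat.iter. rewrite tau_comm, IH. unfold to_LU, iterate, translate. simpl.
      rewrite map_app. generalize (map to_lact (role (negb t))).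
      induction l as [|a l IHl]; simpl; congruence. }
    unfold tauP, P. fold tau. rewrite !map_app, !map_repeat. cbn [map fst snd].
    rewrite E, !tau_comm. reflexivity.
  - exists (X, C'). split; [exact HX|]. unfold l_successful. simpl. rewrite PX.
    rewrite map_map. apply in_map_iff. exists (SCheck, []). auto.
Qed.

Lemma exec_iterate (n : nat) (w : word) (D : cells) :
  exec w D = Some D -> exec (iterate n w) D = Some D.
Proof.
  intros H. induction n as [|n IH]; [reflexivity|].
  unfold iterate in *. simpl. now rewrite (exec_app _ _ _ _ H).
Qed.

(** The newcomer could only halt before a [Take], and then at most [n] of its kind would be
    finished, while the lower bound demands [n + 1]. *)
Lemma next_passes (t : bool) (m n : nat) (L : config bool) (D : cells) :
  reach (crowd t m n) C L D -> Forall finished L -> n < m ->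
  exists D', exec (role (negb t)) D = Some D' /\
    reach (crowd t m (S n)) C ((negb t, []) :: L) D'.
Proof.
  intros H HL Hlt.
  assert (H' : reach (crowd t m (S n)) C ((negb t, role (negb t)) :: L) D).
  { eapply reach_perm_l with (L' := crowd t m n ++ [(negb t, role (negb t))]).
    - unfold crowd. rewrite <- app_assoc. apply Permutation_app_head.
      apply Permutation_cons_append.
    - eapply reach_perm_r; [apply reach_frame, H|].
      symmetry. apply Permutation_cons_append. }
  destruct (exec_cases (role (negb t)) D) as [[D' HD]|(u & l & v & D' & E & HD & Hl)].
  - exists D'. split; [exact HD|]. eapply reach_trans; [exact H'|].
    now apply reach_exec_all.
  - exfalso.
    assert (H2 : reach (crowd t m (S n)) C ((negb t, Take l :: v) :: L) D').
    { eapply reach_trans; [exact H'|]. rewrite E. now apply reach_exec. }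
    assert (Hst : stuck ((negb t, Take l :: v) :: L) D').
    { constructor; [unfold blocked; simpl; now rewrite Hl|].
      eapply Forall_impl; [|exact HL]. intros [x w] Hw. unfold finished, blocked in *.
      simpl in *. now rewrite Hw. }
    assert (Hlow : S n <= done (negb t) ((negb t, Take l :: v) :: L)).
    { apply Nat.le_trans with (min (S n) m); [lia|].
      apply (correct_lower (negb t) (S n) m _ D'); [|exact Hst].
      eapply reach_perm_l; [|exact H2]. unfold crowd. rewrite negb_involutive.
      apply Permutation_app_comm. }
    unfold done in Hlow. rewrite count_cons in Hlow. unfold is_done at 1 in Hlow.
    simpl in Hlow. rewrite andb_false_r in Hlow. simpl in Hlow.
    assert (Hle : count (is_done (negb t)) L <= count (fun x => eqb x (negb t)) (map fst L)).
    { rewrite count_map. clear. induction L as [|e L IH]; [reflexivity|].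
      rewrite !count_cons. unfold is_done at 1. destruct (eqb (fst e) (negb t)), (snd e); simpl; lia. }
    rewrite <- (count_perm _ _ _ (reach_tags _ _ _ _ H)), count_map in Hle.
    unfold crowd in Hle. rewrite count_app, !count_repeat in Hle. simpl in Hle.
    rewrite eqb_reflx in Hle.
    replace (eqb t (negb t)) with false in Hle by (destruct t; reflexivity). lia.
Qed.

(* With two pending messages of kind [t], two processes of the other kind pass
   one after the other; by idempotence arbitrarily many then do. *)
Lemma correct_upper (t : bool) (m n : nat) (L : config bool) (D : cells) :
  reach (crowd t m n) C L D -> Forall finished L -> m <= n + 1.
Proof.
  intros H HL. destruct (le_lt_dec m (n + 1)) as [|Hlt]; [assumption|exfalso].
  destruct (next_passes _ _ _ _ _ H HL) as (D1 & E1 & H1); [lia|].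
  destruct (next_passes _ _ _ _ _ H1) as (D2 & E2 & _);
    [constructor; [reflexivity|exact HL]|lia|].
  (* Now [D1] is a fixed point of the word, where all further copies pass. *)
  rewrite (exec_idempotent _ _ _ _ E1 E2) in E2.
  apply (reach_map (fun _ => SZero)) in H.
  apply (reach_frame _ _ _ _ [(SCheck, iterate (S m) (role (negb t)))]) in H.
  unfold crowd in H. rewrite map_app, !map_repeat, <- app_assoc in H. simpl fst in H.
  simpl snd in H.
  apply (correct_not_through t m n
    ((SCheck, []) :: map (fun e => (SZero, snd e)) L) D1); [|now left].
  eapply reach_trans; [exact H|].
  eapply reach_perm_l; [symmetry; apply Permutation_cons_append|].
  apply reach_exec_all. unfold iterate. simpl.
  rewrite (exec_app _ _ _ _ E1). now apply exec_iterate.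
Qed.

Lemma correct_good : good s r C.
Proof.
  split.
  - intros t m n L D H S. destruct t.
    + apply (correct_lower true m n L D); [exact H|exact S].
    + rewrite Nat.min_comm. apply (correct_lower false n m L D); [|exact S].
      eapply reach_perm_l; [apply crowd_init|exact H].
  - exists 1. intros m n L D H HL. split.
    + exact (correct_upper true m n L D H HL).
    + apply (correct_upper false n m L D); [|exact HL].
      eapply reach_perm_l; [apply crowd_init|exact H].
Qed.

Lemma correct_absurd : False.
Proof.
  (* With [m = n = 0] these are [!✓] and [?✓]; with [m = 1] and [n = 0], [double] treats [!0 | ??✓]
     and [?0 | !!✓]. *)
  assert (alone : forall t D, exec (role (negb t)) C <> Some D).
  { intros t D H. apply (correct_not_through t 0 0 [(SCheck, [])] D); [|now left].
    apply reach_exec_all. unfold iterate. simpl. now rewrite app_nil_r. }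
  assert (double : forall t L D,
    reach [(SZero, role t); (SCheck, role (negb t) ++ role (negb t))] C L D ->
    ~ In (SCheck, []) L).
  { intros t L D H. apply (correct_not_through t 1 0 L D).
    unfold iterate. simpl. now rewrite app_nil_r. }
  apply (good_absurd s r C correct_good).
  - exact (alone false).
  - exact (alone true).
  - exact (double true).
  - exact (double false).
Qed.

End Correct.

Theorem theorem5p17 :
  forall (IS : store) (tsend trecv : list lact),
    word_ok 2 tsend -> word_ok 2 trecv ->
    ~ correct_translation IS tsend trecv.
Proof.
  intros IS tsend trecv Hs Hr H.
  destruct (word_ok_translate _ Hs) as [s ->].
  destruct (word_ok_translate _ Hr) as [r ->].
  apply (correct_absurd IS s r (IS 0, IS 1) H).
  intros []; reflexivity.
Qed.
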